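(* Let $S,T\in\operatorname{End}(V\otimes V)$ be of six-vertex form (i.e. $d_1=d_2=0$), and assume that $a_1(S),a_2(S),b_1(S),b_2(S),c_1(S),c_2(S),a_1(T),a_2(T),b_1(T),b_2(T),c_1(T),c_2(T)$ are all nonzero. Then a necessary and sufficient condition for there to exist an $R\in\operatorname{End}(V\otimes V)$ of six-vertex form with $c_1(R)\neq 0$, $c_2(R)\neq 0$ and $\llbracket R,S,T\rrbracket=0$ is that $$\triangle_1(S)=\triangle_1(T)\quad\text{and}\quad \triangle_2(S)=\triangle_2(T).$$
   Context: Let $V$ be a two-dimensional complex vector space with basis $v_+,v_-$. Identify $\operatorname{End}(V\otimes V)$ with $4\times4$ matrices using the ordered basis $v_+\otimes v_+,\ v_+\otimes v_-,\ v_-\otimes v_+,\ v_-\otimes v_-$ (matrices act on column vectors). For a matrix of the form $$R=\begin{pmatrix}a_1&0&0&d_1\\0&b_1&c_1&0\\0&c_2&b_2&0\\d_2&0&0&a_2\end{pmatrix}$$ write $a_1(R)=a_1$, $a_2(R)=a_2$, $b_1(R)=b_1$, etc. $R$ is said to be of six-vertex form if it has this shape with $d_1=d_2=0$. For $\phi\in\operatorname{End}(V\otimes V)$ define $\phi_{12},\phi_{13},\phi_{23}\in\operatorname{End}(V\otimes V\otimes V)$ by requiring, for $\phi=\phi'\otimes\phi''$ with $\phi',\phi''\in\operatorname{End}(V)$, $\phi_{12}=\phi'\otimes\phi''\otimes1$, $\phi_{13}=\phi'\otimes1\otimes\phi''$, $\phi_{23}=1\otimes\phi'\otimes\phi''$,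 and extending linearly. The Yang–Baxter commutator is $\llbracket\phi,\psi,\chi\rrbracket=\phi_{12}\psi_{13}\chi_{23}-\chi_{23}\psi_{13}\phi_{12}$. For $R$ of six-vertex form with $a_1b_1a_2b_2\neq0$ set $$\triangle_1(R)=\frac{a_1a_2+b_1b_2-c_1c_2}{2a_1b_1},\qquad \triangle_2(R)=\frac{a_1a_2+b_1b_2-c_1c_2}{2a_2b_2},$$ where $a_1=a_1(R)$, etc. *)

(* Defs.v *)
From HB Require Import structures.
From mathcomp Require Import all_boot all_order all_algebra.
From mathcomp Require Export reals.
From mathcomp.real_closed Require Export complex mxtens.
From mathcomp Require Import ring.

Set Implicit Arguments.
Unset Strict Implicit.
Unset Printing Implicit Defensive.

Import GRing.Theory.
Local Open Scope ring_scope.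

Notation "A *t B" := (tensmx A B)
  (at level 40, left associativity, format "A  *t  B") : ring_scope.

(* End(V) is 'M_2, with v_+ and v_- the basis vectors 0 and 1 of V.  End(V (x) V)
   is 'M_(2 * 2): [mxtens_index (i, j)], of value 2 * i + j, is the position of
   v_i (x) v_j, so the ordered basis is v_++, v_+-, v_-+, v_--.  The entry A i j
   is the coefficient of the basis vector i in the image of the basis vector j. *)
Definition ipp : 'I_(2 * 2) := mxtens_index (0, 0).
Definition ipm : 'I_(2 * 2) := mxtens_index (0, 1).
Definition imp : 'I_(2 * 2) := mxtens_index (1, 0).
Definition imm : 'I_(2 * 2) := mxtens_index (1, 1).

Section Weights.
Variable K : fieldType.
Implicit Types R phi psi chi : 'M[K]_(2 * 2).

Definition vertex_mx (a1 a2 b1 b2 c1 c2 d1 d2 : K) : 'M[K]_(2 * 2) :=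
  \matrix_(i, j) (nth [::] [:: [:: a1; 0;  0;  d1];
                              [:: 0;  b1; c1; 0 ];
                              [:: 0;  c2; b2; 0 ];
                              [:: d2; 0;  0;  a2]] i)`_j.

Definition a1 R := R ipp ipp.
Definition a2 R := R imm imm.
Definition b1 R := R ipm ipm.
Definition b2 R := R imp imp.
Definition c1 R := R ipm imp.
Definition c2 R := R imp ipm.
Definition d1 R := R ipp imm.
Definition d2 R := R imm ipp.

Definition eight_vertex_form R : Prop :=
  R = vertex_mx (a1 R) (a2 R) (b1 R) (b2 R) (c1 R) (c2 R) (d1 R) (d2 R).

Definition six_vertex_form R : Prop :=
  [/\ eight_vertex_form R, d1 R = 0 & d2 R = 0].

Definition triangle1 R : K :=
  (a1 R * a2 R + b1 R * b2 R - c1 R * c2 R) / (2%:R * a1 R * b1 R).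
Definition triangle2 R : K :=
  (a1 R * a2 R + b1 R * b2 R - c1 R * c2 R) / (2%:R * a2 R * b2 R).

(* The linear extension to End(V (x) V) of a bilinear f, obtained by expanding
   phi on the basis E_ij (x) E_kl; see [tens_extE]. *)
Definition tens_ext (W : lmodType K) (f : 'M[K]_2 -> 'M[K]_2 -> W) phi : W :=
  \sum_i \sum_j \sum_k \sum_l
     phi (mxtens_index (i, k)) (mxtens_index (j, l))
       *: f (delta_mx i j) (delta_mx k l).

Definition leg12 phi : 'M[K]_(2 * 2 * 2) :=
  tens_ext (fun A B => A *t B *t 1%:M) phi.
Definition leg13 phi : 'M[K]_(2 * 2 * 2) :=
  tens_ext (fun A B => A *t 1%:M *t B) phi.
Definition leg23 phi : 'M[K]_(2 * 2 * 2) :=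
  tens_ext (fun A B => 1%:M *t A *t B) phi.

Definition yb_comm phi psi chi : 'M[K]_(2 * 2 * 2) :=
  leg12 phi *m leg13 psi *m leg23 chi - leg23 chi *m leg13 psi *m leg12 phi.

Lemma tens_ext_linear (W : lmodType K) (f : 'M[K]_2 -> 'M[K]_2 -> W) :
  linear (tens_ext f).
Proof.
move=> c phi psi; rewrite /tens_ext.
do 4!(rewrite scaler_sumr -big_split /=; apply: eq_bigr => ? _).
by rewrite !mxE scalerDl scalerA.
Qed.

Lemma tens_extE (W : lmodType K) (f : 'M[K]_2 -> 'M[K]_2 -> W) A B :
  (forall Y, linear (f^~ Y)) -> (forall X, linear (f X)) ->
  tens_ext f (A *t B) = f A B.
Proof.
move=> fl fr.
have sumE (g : 'M[K]_2 -> W) : linear g -> forall X,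
    g X = \sum_i \sum_j X i j *: g (delta_mx i j).
  move=> lg X.
  pose G := GRing.isLinear.Build K 'M[K]_2 W *:%R g lg.
  pose h : {linear 'M[K]_2 -> W} := HB.pack g G.
  rewrite [X in LHS]matrix_sum_delta -[g]/(h : _ -> _) linear_sum.
  apply: eq_bigr => i _; rewrite linear_sum; apply: eq_bigr => j _.
  by rewrite linearZ.
rewrite (sumE _ (fl B)) /tens_ext; apply: eq_bigr => i _; apply: eq_bigr => j _.
rewrite (sumE _ (fr _)) scaler_sumr; apply: eq_bigr => k _.
by rewrite scaler_sumr; apply: eq_bigr => l _; rewrite tensmxE scalerA.
Qed.

Lemma leg12_tens A B : leg12 (A *t B) = A *t B *t 1%:M.
Proof.
apply: (@tens_extE _ (fun A B => A *t B *t 1%:M)) => ? ? ? ?;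
  by apply/matrixP => ? ?; rewrite !mxE; ring.
Qed.

Lemma leg13_tens A B : leg13 (A *t B) = A *t 1%:M *t B.
Proof.
apply: (@tens_extE _ (fun A B => A *t 1%:M *t B)) => ? ? ? ?;
  by apply/matrixP => ? ?; rewrite !mxE; ring.
Qed.

Lemma leg23_tens A B : leg23 (A *t B) = 1%:M *t A *t B.
Proof.
apply: (@tens_extE _ (fun A B => 1%:M *t A *t B)) => ? ? ? ?;
  by apply/matrixP => ? ?; rewrite !mxE; ring.
Qed.

End Weights.

(* Main.v *)
Require Import Defs.
From mathcomp Require Import all_boot all_order all_algebra.
From mathcomp Require Import ring.

Set Implicit Arguments.
Unset Strict Implicit.
Unset Printing Implicit Defensive.

Import GRing.Theory Num.Theory.
Local Open Scope ring_scope.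

(** Entrywise, [yb_comm R S T = 0] is a system of cubic equations in the weights
    (fourteen, one of them repeated).  Up to a common scalar, nine of these determine
    R from S and T: c1(R) c2(S) c1(T) = c2(R) c1(S) c2(T) fixes c1(R) : c2(R), the
    four equations without a-weights of R then give b1(R) and b2(R), and the four
    with a_i(R) c_j(S) a_i(T) as a term give a1(R) and a2(R).  Substituting these
    values in the four remaining equations, those with a_i(R) b_i(S) c_j(T) as a
    term, turns them into the cross-multiplied forms of
    [triangle1 S = triangle1 T] and [triangle2 S = triangle2 T]. *)

Lemma sum_mxtens (V : nmodType) m n (F : 'I_(m * n) -> V) :
  \sum_x F x = \sum_i \sum_j F (mxtens_index (i, j)).
Proof.
rewrite pair_bigA /= (reindex (@mxtens_index m n)) /=; first by apply: eq_bigr => -[].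
by exists (@mxtens_unindex m n) => ? _; rewrite ?mxtens_indexK ?mxtens_unindexK.
Qed.

Section Legs.
Variable K : fieldType.
Implicit Types R S T phi : 'M[K]_(2 * 2).

Local Notation idx2 i j := (mxtens_index (i, j)).
Local Notation idx3 i j k := (mxtens_index (mxtens_index (i, j), k)).

(** By hypothesis this entry of [f A B] sees only one entry of [A] and one of [B], so a single pair
    of basis matrices survives in the fourfold sum. The scalar [c] carries the Kronecker delta of
    the identity leg. *)
Lemma tens_ext_entry m n (f : 'M[K]_2 -> 'M[K]_2 -> 'M[K]_(m, n)) phi x y i j k l c :
  (forall A B, f A B x y = A i j * B k l * c) ->
  tens_ext f phi x y = phi (idx2 i k) (idx2 j l) * c.
Proof.
move=> fE; rewrite /tens_ext.
transitivity (\sum_i' \sum_j' \sum_k' \sum_l' phi (idx2 i' k') (idx2 j' l') *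
    (((i == i') && (j == j'))%:R * ((k == k') && (l == l'))%:R * c)).
  by do 4!(rewrite summxE; apply: eq_bigr => ? _); rewrite mxE fE !mxE.
rewrite (big_only1 i) // => [|i' /negbTE ni _]; last first.
  by do 3!apply: big1 => ? _; rewrite eq_sym ni !mul0r mulr0.
rewrite (big_only1 j) // => [|j' /negbTE nj _]; last first.
  by do 2!apply: big1 => ? _; rewrite [j == _]eq_sym nj andbF !mul0r mulr0.
rewrite (big_only1 k) // => [|k' /negbTE nk _]; last first.
  by apply: big1 => ? _; rewrite [k == _]eq_sym nk mulr0 !mul0r mulr0.
rewrite (big_only1 l) // => [|l' /negbTE nl _]; last first.
  by rewrite [l == _]eq_sym nl andbF mulr0 !mul0r mulr0.
by rewrite !eqxx !mul1r.
Qed.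

Lemma leg12E phi i j k i' j' k' :
  leg12 phi (idx3 i j k) (idx3 i' j' k') =
  phi (idx2 i j) (idx2 i' j') * (k == k')%:R.
Proof. by apply: tens_ext_entry => A B; rewrite !tensmxE mxE. Qed.

Lemma leg13E phi i j k i' j' k' :
  leg13 phi (idx3 i j k) (idx3 i' j' k') =
  phi (idx2 i k) (idx2 i' k') * (j == j')%:R.
Proof. by apply: tens_ext_entry => A B; rewrite !tensmxE mxE mulrAC. Qed.

Lemma leg23E phi i j k i' j' k' :
  leg23 phi (idx3 i j k) (idx3 i' j' k') =
  phi (idx2 j k) (idx2 j' k') * (i == i')%:R.
Proof. by apply: tens_ext_entry => A B; rewrite !tensmxE mxE -mulrA mulrC. Qed.

Lemma sum2E (V : nmodType) (F : 'I_2 -> V) : \sum_i F i = F 0 + F 1.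
Proof. by rewrite big_ord_recl big_ord1; congr (_ + F _); apply: val_inj. Qed.

Lemma ord2P (P : 'I_2 -> Prop) : P 0 -> P 1 -> forall i, P i.
Proof.
move=> P0 P1 [[|[|//]] lti]; first by rewrite (_ : Ordinal _ = 0) //; apply: val_inj.
by rewrite (_ : Ordinal _ = 1) //; apply: val_inj.
Qed.

(** The first leg map fixes the third tensor index and the second fixes the middle one, so of the
    intermediate triple only the first index [p] stays free. *)
Lemma leg12_leg13E R S i j k i' j' k' :
  (leg12 R *m leg13 S) (idx3 i j k) (idx3 i' j' k') =
  \sum_p R (idx2 i j) (idx2 p j') * S (idx2 p k) (idx2 i' k').
Proof.
rewrite mxE !sum_mxtens; apply: eq_bigr => p _; rewrite !sum2E !leg12E !leg13E.
by elim/ord2P: j'; elim/ord2P: k; rewrite !(mulr0, mul0r, mulr1, addr0, add0r).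
Qed.

Lemma leg23_leg13E T S i j k i' j' k' :
  (leg23 T *m leg13 S) (idx3 i j k) (idx3 i' j' k') =
  \sum_r T (idx2 j k) (idx2 j' r) * S (idx2 i r) (idx2 i' k').
Proof.
rewrite mxE !sum_mxtens !sum2E !leg23E !leg13E.
by elim/ord2P: j'; elim/ord2P: i; rewrite !(mulr0, mul0r, mulr1, addr0, add0r).
Qed.

(** State sums for the two sides of the Yang-Baxter equation: [p], [q], [r] label the internal edges
    on the first, second and third strand, joining [R] to [S], [R] to [T] and [S] to [T]. *)
Lemma yb_commE R S T i j k i' j' k' :
  yb_comm R S T (idx3 i j k) (idx3 i' j' k') =
  \sum_p \sum_q \sum_r
     (R (idx2 i j) (idx2 p q) * S (idx2 p k) (idx2 i' r)
        * T (idx2 q r) (idx2 j' k')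
      - T (idx2 j k) (idx2 q r) * S (idx2 i r) (idx2 p k')
        * R (idx2 p q) (idx2 i' j')).
Proof.
rewrite /yb_comm !mxE !sum_mxtens !sum2E.
rewrite !leg12_leg13E !leg23_leg13E !leg12E !leg23E !sum2E.
elim/ord2P: i'; elim/ord2P: k' => /=; rewrite !(mulr0, mulr1, addr0, add0r); ring.
Qed.

(** The ice rule written as index tests: once the indices are concrete, each entry computes to a
    single weight or to 0. *)
Definition six_vertex_entry R (i j i' j' : 'I_2) : K :=
  if (i == i') && (j == j') then
    if i == j then if i == 0 then a1 R else a2 R
    else if i == 0 then b1 R else b2 R
  else if (i == j') && (j == i') then if i == 0 then c1 R else c2 R
  else 0.

Lemma six_vertexE R i j i' j' : six_vertex_form R ->
  R (idx2 i j) (idx2 i' j') = six_vertex_entry R i j i' j'.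
Proof.
case=> R8 d1R d2R; rewrite {1}R8 d1R d2R mxE /six_vertex_entry.
by elim/ord2P: i; elim/ord2P: j; elim/ord2P: i'; elim/ord2P: j'.
Qed.

Lemma yb_comm_six_vertexE R S T i j k i' j' k' :
  six_vertex_form R -> six_vertex_form S -> six_vertex_form T ->
  yb_comm R S T (idx3 i j k) (idx3 i' j' k') =
  \sum_p \sum_q \sum_r
     (six_vertex_entry R i j p q * six_vertex_entry S p k i' r
        * six_vertex_entry T q r j' k'
      - six_vertex_entry T j k q r * six_vertex_entry S i r p k'
        * six_vertex_entry R p q i' j').
Proof.
move=> hR hS hT; rewrite yb_commE.
by do 3!apply: eq_bigr => ? _; rewrite !six_vertexE.
Qed.

Ltac expand := rewrite !sum2E /six_vertex_entry /=
  ?(mul0r, mulr0, oppr0, addr0, add0r).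

Lemma yb_comm_eq0 R S T :
  six_vertex_form R -> six_vertex_form S -> six_vertex_form T ->
  yb_comm R S T = 0 <->
  [/\ [/\ a1 R * b1 S * c1 T = c2 R * c1 S * b1 T + b1 R * a1 S * c1 T,
          a1 R * b1 S * c2 T = c1 R * c2 S * b1 T + b1 R * a1 S * c2 T,
          a2 R * b2 S * c1 T = c2 R * c1 S * b2 T + b2 R * a2 S * c1 T &
          a2 R * b2 S * c2 T = c1 R * c2 S * b2 T + b2 R * a2 S * c2 T],
      [/\ a1 R * c1 S * a1 T = b2 R * c1 S * b1 T + c1 R * a1 S * c1 T,
          a1 R * c2 S * a1 T = b2 R * c2 S * b1 T + c2 R * a1 S * c2 T,
          a2 R * c1 S * a2 T = b1 R * c1 S * b2 T + c1 R * a2 S * c1 T &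
          a2 R * c2 S * a2 T = b1 R * c2 S * b2 T + c2 R * a2 S * c2 T],
      [/\ c1 R * b2 S * a1 T = b2 R * c1 S * c2 T + c1 R * a1 S * b2 T,
          c2 R * b2 S * a1 T = b2 R * c2 S * c1 T + c2 R * a1 S * b2 T,
          c1 R * b1 S * a2 T = b1 R * c1 S * c2 T + c1 R * a2 S * b1 T &
          c2 R * b1 S * a2 T = b1 R * c2 S * c1 T + c2 R * a2 S * b1 T] &
      c1 R * c2 S * c1 T = c2 R * c1 S * c2 T].
Proof.
move=> hR hS hT; split=> [yb0|].
  have entry i j k i' j' k' :=
    etrans (esym (yb_comm_six_vertexE i j k i' j' k' hR hS hT))
      (etrans (congr1 (fun M : 'M_(2 * 2 * 2) => M (idx3 i j k) (idx3 i' j' k')) yb0)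
         (mxE _ _ _ _)).
  (* Each equation is one entry of the commutator; [symmetry] is called when that entry is the right
     side minus the left. *)
  split; [split|split|split|].
  - apply: subr0_eq; rewrite -[RHS](entry 0 0 1 0 1 0); expand; ring.
  - symmetry; apply: subr0_eq; rewrite -[RHS](entry 0 1 0 0 0 1); expand; ring.
  - symmetry; apply: subr0_eq; rewrite -[RHS](entry 1 0 1 1 1 0); expand; ring.
  - apply: subr0_eq; rewrite -[RHS](entry 1 1 0 1 0 1); expand; ring.
  - apply: subr0_eq; rewrite -[RHS](entry 0 0 1 1 0 0); expand; ring.
  - symmetry; apply: subr0_eq; rewrite -[RHS](entry 1 0 0 0 0 1); expand; ring.
  - symmetry; apply: subr0_eq; rewrite -[RHS](entry 0 1 1 1 1 0); expand; ring.
  - apply: subr0_eq; rewrite -[RHS](entry 1 1 0 0 1 1); expand; ring.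
  - apply: subr0_eq; rewrite -[RHS](entry 0 1 0 1 0 0); expand; ring.
  - symmetry; apply: subr0_eq; rewrite -[RHS](entry 1 0 0 0 1 0); expand; ring.
  - symmetry; apply: subr0_eq; rewrite -[RHS](entry 0 1 1 1 0 1); expand; ring.
  - apply: subr0_eq; rewrite -[RHS](entry 1 0 1 0 1 1); expand; ring.
  - apply: subr0_eq; rewrite -[RHS](entry 0 1 0 0 1 0); expand; ring.
case=> -[h1 h2 h3 h4] [h5 h6 h7 h8] [h9 h10 h11 h12] h13.
apply/matrixP => x y; case: (mxtens_indexP x) => ij k; case: (mxtens_indexP ij) => i j.
case: (mxtens_indexP y) => ij' k'; case: (mxtens_indexP ij') => i' j'.
rewrite [RHS]mxE yb_comm_six_vertexE //.
elim/ord2P: i; elim/ord2P: j; elim/ord2P: k; elim/ord2P: i'; elim/ord2P: j';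
  elim/ord2P: k'; expand; try by ring.
(* Entries that violate the ice rule, and six of the eight diagonal ones, vanish identically. The
   others come in lexicographic order of the indices; the diagonal entries at + - + and - + - both
   give [h13]. *)
- by ring: h1.
- by ring: h5.
- by ring: h2.
- by ring: h13.
- by ring: h9.
- by ring: h11.
- by ring: h7.
- by ring: h6.
- by ring: h10.
- by ring: h12.
- by ring: h13.
- by ring: h3.
- by ring: h8.
- by ring: h4.
Qed.

Lemma cross_of_yb (ra1 rb1 rb2 rc1 rc2 sa1 sa2 sb1 sb2 sc1 sc2
    ta1 ta2 tb1 tb2 tc1 tc2 : K) :
  rc1 != 0 -> tc1 != 0 ->
  ra1 * sb1 * tc1 = rc2 * sc1 * tb1 + rb1 * sa1 * tc1 ->
  ra1 * sc1 * ta1 = rb2 * sc1 * tb1 + rc1 * sa1 * tc1 ->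
  rc1 * sb2 * ta1 = rb2 * sc1 * tc2 + rc1 * sa1 * tb2 ->
  rc1 * sb1 * ta2 = rb1 * sc1 * tc2 + rc1 * sa2 * tb1 ->
  rc1 * sc2 * tc1 = rc2 * sc1 * tc2 ->
  (sa1 * sa2 + sb1 * sb2 - sc1 * sc2) * (ta1 * tb1) =
  (ta1 * ta2 + tb1 * tb2 - tc1 * tc2) * (sa1 * sb1).
Proof.
move=> rc1N0 tc1N0 h1 h5 h9 h11 h13.
apply: (mulfI (mulf_neq0 rc1N0 tc1N0)).
(* The multipliers eliminate the weights of R in turn: [h1] against [h5] removes [ra1], then [h9],
   [h11] and [h13] remove [rb2], [rb1] and [rc2]. What remains is the claim times [rc1 * tc1]. *)
apply: subr0_eq; transitivity
  (ta1 * sc1 * tc2 * (ra1 * sb1 * tc1 - (rc2 * sc1 * tb1 + rb1 * sa1 * tc1))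
   - sb1 * tc1 * tc2 * (ra1 * sc1 * ta1 - (rb2 * sc1 * tb1 + rc1 * sa1 * tc1))
   + sb1 * tc1 * tb1 * (rc1 * sb2 * ta1 - (rb2 * sc1 * tc2 + rc1 * sa1 * tb2))
   - sa1 * tc1 * ta1 * (rc1 * sb1 * ta2 - (rb1 * sc1 * tc2 + rc1 * sa2 * tb1))
   - sc1 * tb1 * ta1 * (rc1 * sc2 * tc1 - rc2 * sc1 * tc2)); first by ring.
by rewrite h1 h5 h9 h11 h13; ring.
Qed.

(** The fraction is the weight a1(R) of the solution constructed in [theorem1]. For that R the
    conclusion is the equation in a1(R) b1(S) c1(T) divided by c1(T), and also the one in a1(R)
    b1(S) c2(T) divided by c2(T). *)
Lemma yb_of_cross (sa1 sa2 sb1 sb2 sc1 sc2 ta1 ta2 tb1 tb2 tc1 tc2 : K) :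
  ta1 != 0 ->
  (sa1 * sa2 + sb1 * sb2 - sc1 * sc2) * (ta1 * tb1) =
  (ta1 * ta2 + tb1 * tb2 - tc1 * tc2) * (sa1 * sb1) ->
  ((sb2 * ta1 - sa1 * tb2) * tb1 + sa1 * tc1 * tc2) / ta1 * sb1 =
  sc1 * sc2 * tb1 + (sb1 * ta2 - sa2 * tb1) * sa1.
Proof.
move=> ta1N0 h; apply: subr0_eq; transitivity
  (((sa1 * sa2 + sb1 * sb2 - sc1 * sc2) * (ta1 * tb1)
    - (ta1 * ta2 + tb1 * tb2 - tc1 * tc2) * (sa1 * sb1)) / ta1).
  by field.
by rewrite h subrr mul0r.
Qed.

Lemma six_vertex_form_mx (x1 x2 y1 y2 z1 z2 : K) :
  six_vertex_form (vertex_mx x1 x2 y1 y2 z1 z2 0 0).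
Proof. by split; rewrite /eight_vertex_form /d1 /d2 /a1 /a2 /b1 /b2 /c1 /c2 !mxE. Qed.

Lemma vertex_mxE (x1 x2 y1 y2 z1 z2 : K) (M := vertex_mx x1 x2 y1 y2 z1 z2 0 0) :
  (a1 M = x1) * (a2 M = x2) * (b1 M = y1) * (b2 M = y2) * (c1 M = z1) * (c2 M = z2).
Proof. by rewrite /a1 /a2 /b1 /b2 /c1 /c2 !mxE. Qed.

Lemma triangle_eq (x y u v u' v' : K) : 2%:R != 0 :> K ->
  u != 0 -> v != 0 -> u' != 0 -> v' != 0 ->
  x / (2%:R * u * v) = y / (2%:R * u' * v') <-> x * (u' * v') = y * (u * v).
Proof.
move=> n2 u0 v0 u'0 v'0; rewrite -!mulrA; split=> [/eqP|e].
  rewrite eqr_div ?mulf_neq0 // => /eqP e; apply: (mulfI n2).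
  by rewrite mulrCA e mulrCA.
by apply/eqP; rewrite eqr_div ?mulf_neq0 // ![_ * (2%:R * _)]mulrCA e.
Qed.

End Legs.

Theorem theorem1 (F : realType) (S T : 'M[F[i]]_(2 * 2))
    (hS : six_vertex_form S) (hT : six_vertex_form T)
    (a1S : a1 S <> 0) (a2S : a2 S <> 0) (b1S : b1 S <> 0) (b2S : b2 S <> 0)
    (c1S : c1 S <> 0) (c2S : c2 S <> 0)
    (a1T : a1 T <> 0) (a2T : a2 T <> 0) (b1T : b1 T <> 0) (b2T : b2 T <> 0)
    (c1T : c1 T <> 0) (c2T : c2 T <> 0) :
  (exists R : 'M[F[i]]_(2 * 2),
     [/\ six_vertex_form R, c1 R <> 0, c2 R <> 0 & yb_comm R S T = 0])
  <-> (triangle1 S = triangle1 T /\ triangle2 S = triangle2 T).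
Proof.
have n2 : 2%:R != 0 :> F[i] by rewrite pnatr_eq0.
move/eqP: (a1S) (a2S) (b1S) (b2S) (a1T) (a2T) (b1T) (b2T) (c1T) (c2T).
move=> a1S0 /eqP a2S0 /eqP b1S0 /eqP b2S0 /eqP a1T0 /eqP a2T0 /eqP b1T0 /eqP b2T0.
move=> /eqP c1T0 /eqP c2T0; rewrite /triangle1 /triangle2 !triangle_eq //.
split=> [[R [hR /eqP c1R /eqP c2R]]|[cross1 cross2]].
  case/yb_comm_eq0 => // -[h1 h2 h3 h4] [h5 h6 h7 h8] [h9 h10 h11 h12] h13; split.
    exact: cross_of_yb c1R c1T0 h1 h5 h9 h11 h13.
  (* Swapping the indices 1 and 2 preserves the system of equations. *)
  have := cross_of_yb c2R c2T0 h4 h8 h12 h10 (esym h13).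
  by rewrite ![a2 _ * a1 _]mulrC ![b2 _ * b1 _]mulrC ![c2 _ * c1 _]mulrC.
(* The second relation in the shape of the first with the indices 1 and 2 exchanged, so that
   [yb_of_cross] applies to both. *)
have cross2' : (a2 S * a1 S + b2 S * b1 S - c2 S * c1 S) * (a2 T * b2 T) =
    (a2 T * a1 T + b2 T * b1 T - c2 T * c1 T) * (a2 S * b2 S).
  by rewrite ![a2 _ * a1 _]mulrC ![b2 _ * b1 _]mulrC ![c2 _ * c1 _]mulrC.
have e1 := yb_of_cross a1T0 cross1; have e2 := yb_of_cross a2T0 cross2'.
(* The scale of R is fixed by taking c1(R) = c1(S) c2(T) and c2(R) = c2(S) c1(T); the b-weights are
   then polynomial, and solving for the a-weights divides only by a1(T) and a2(T). *)
exists (vertex_mx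
  (((b2 S * a1 T - a1 S * b2 T) * b1 T + a1 S * c1 T * c2 T) / a1 T)
  (((b1 S * a2 T - a2 S * b1 T) * b2 T + a2 S * c2 T * c1 T) / a2 T)
  (b1 S * a2 T - a2 S * b1 T) (b2 S * a1 T - a1 S * b2 T)
  (c1 S * c2 T) (c2 S * c1 T) 0 0).
have hR := six_vertex_form_mx; split; rewrite ?vertex_mxE //.
- by apply/eqP; rewrite mulf_neq0 //; apply/eqP.
- by apply/eqP; rewrite mulf_neq0 //; apply/eqP.
apply/yb_comm_eq0 => //; rewrite !vertex_mxE e1 e2.
(* The triangle conditions enter only the first four equations, where [e1] and [e2] have already
   replaced the left sides; the other nine are identities. *)
split; [split|split|split|]; by [ring | field].
Qed.
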